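(* Let $M\subset\mathbb{C}^9$ be the real submanifold of real codimension $5$ through $0$ given in the coordinates $(z,w)=(z_1,\dots,z_4,w_1,\dots,w_5)$ by $$\operatorname{Im} w_1= z_1\overline{z_2}+z_2\overline{z_1},\qquad \operatorname{Im} w_2=-i z_1\overline{z_2}+i z_2\overline{z_1},$$ $$\operatorname{Im} w_3= z_3\overline{z_2}+z_4\overline{z_1}+z_2\overline{z_3}+z_1\overline{z_4},\qquad \operatorname{Im} w_4=z_1\overline{z_1},\qquad \operatorname{Im} w_5=z_2\overline{z_2}.$$ Then $M$ is Levi generating at $0$, that is, of finite type at $0$ with $2$ the only H\''ormander number, and its Levi map at $0$ is non-degenerate.
   Context: Let $T^cM=TM\cap iTM$ be the complex tangent bundle. $M$ is of finite type at $0$ with $2$ the only H\''ormander number if the sections of $T^cM$ together with their first-order Lie brackets span $T_0M$. The Levi map at $0$ is the vector-valued Hermitian map $T^c_0M\times T^c_0M\to (T_0M/T^c_0M)\otimes\mathbb{C}$ induced by the bracket of $(1,0)$ and $(0,1)$ vector fields; it is non-degenerate if no nonzero vector of $T^c_0M$ pairs to zero with all of $T^c_0M$. For a quadric $\operatorname{Im} w_j=P_j(z,\bar z)$ with Hermitian matrices $A_j$ this means that the $A_j$ have trivial common kernel. *)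

(* Defs.v *)
From HB Require Import structures.
From mathcomp Require Import all_boot all_order all_algebra.
From mathcomp Require Import all_classical all_reals all_analysis.
From mathcomp Require Import complex.
From mathcomp Require Import lra.

Set Implicit Arguments.
Unset Strict Implicit.
Unset Printing Implicit Defensive.
Import Order.TTheory GRing.Theory Num.Theory.
Import numFieldNormedType.Exports.

Local Open Scope classical_set_scope.
Local Open Scope ring_scope.
Local Open Scope complex_scope.

Section smooth_maps.
Context {R : realType} {V W : normedModType R}.

(* For finite-dimensional V and k > 0 this is the usual class C^k on an open
   set U: continuity of all directional derivatives of order k amounts to
   continuity of all partial derivatives of order k. *)
Fixpoint Cdiff (k : nat) (U : set V) (f : V -> W) : Prop :=
  match k with
  | 0 => forall p, U p -> {for p, continuous f}
  | k'.+1 => (forall p, U p -> differentiable f p) /\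
             (forall v, Cdiff k' U (fun p => 'D_v f p))
  end.

Definition smooth (U : set V) (f : V -> W) : Prop := forall k, Cdiff k U f.

Definition real_span (S : set V) : set V :=
  [set v | exists m (c : 'I_m -> R) (s : 'I_m -> V),
     (forall i, S (s i)) /\ v = \sum_i c i *: s i].

Definition lie_bracket (X Y : V -> V) (p : V) : V :=
  'D_(X p) Y p - 'D_(Y p) X p.

End smooth_maps.

(* C^n as a real normed space, (x, y) standing for x + i y. *)
Notation Cspace R n := ('rV[R]_n * 'rV[R]_n)%type.

Definition coord (R : realType) (n : nat) (p : Cspace R n) (k : 'I_n) : R[i] :=
  p.1 0 k +i* p.2 0 k.

Definition mulI (R : realType) (n : nat) (v : Cspace R n) : Cspace R n :=
  (- v.2, v.1).

Record submanifold (R : realType) (n d : nat) := Submanifold {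
  points : set (Cspace R n);
  local_equations : forall p, points p ->
    exists (U : set (Cspace R n)) (rho : Cspace R n -> 'rV[R]_d),
      [/\ open U, U p, smooth U rho,
          (forall q, U q -> (points q <-> rho q = 0)) &
          (forall q, U q -> points q -> forall y, exists v, 'd rho q v = y)]
}.

Section CR_structure.
Context (R : realType) (n d : nat) (M : submanifold R n d).

Definition tangent (p : Cspace R n) : set (Cspace R n) :=
  [set v | exists (I : set R) (gamma : R -> Cspace R n),
     [/\ open I, I 0, smooth I gamma, (forall t, I t -> points M (gamma t)) &
         gamma 0 = p /\ 'D_1 gamma 0 = v]].

Definition complex_tangent (p : Cspace R n) : set (Cspace R n) :=
  tangent p `&` (@mulI R n @` tangent p).

(* Smooth sections over M near p of a family E of subspaces are restrictions of
   smooth maps defined on an open set of the ambient space; the bracket of two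
   vector fields tangent to M does not depend on the chosen extensions. *)
Definition section_at (V : normedModType R) (E : Cspace R n -> set V)
    (p : Cspace R n) (X : Cspace R n -> V) : Prop :=
  exists U : set (Cspace R n),
    [/\ open U, U p, smooth U X & forall q, U q -> points M q -> E q (X q)].

(* Finite type at p with 2 the only Hormander number. *)
Definition levi_generating (p : Cspace R n) : Prop :=
  real_span
    ([set v | exists2 X, section_at complex_tangent p X & v = X p] `|`
     [set v | exists X Y, [/\ section_at complex_tangent p X,
                              section_at complex_tangent p Y &
                              v = lie_bracket X Y p]])
  = tangent p.

(* Complexified vectors: (u, v) stands for u + i v in C^n (x)_R C. The i of the
   second factor is distinct from the complex structure mulI of C^n. *)
Local Notation CCspace := (Cspace R n * Cspace R n)%type.

Definition cscale (c : R[i]) (Z : CCspace) : CCspace :=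
  (complex.Re c *: Z.1 - complex.Im c *: Z.2,
   complex.Re c *: Z.2 + complex.Im c *: Z.1).

Definition cconj (Z : CCspace) : CCspace := (Z.1, - Z.2).

Definition complexify (S : set (Cspace R n)) : set CCspace :=
  [set Z | S Z.1 /\ S Z.2].

(* C-bilinear extension of lie_bracket. *)
Definition clie_bracket (L K : Cspace R n -> CCspace) (p : Cspace R n) :
    CCspace :=
  let L1 q := (L q).1 in let L2 q := (L q).2 in
  let K1 q := (K q).1 in let K2 q := (K q).2 in
  (lie_bracket L1 K1 p - lie_bracket L2 K2 p,
   lie_bracket L1 K2 p + lie_bracket L2 K1 p).

Definition tangent10 (p : Cspace R n) : set CCspace :=
  [set Z | complexify (tangent p) Z /\ (mulI Z.1, mulI Z.2) = cscale 'i%C Z].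

(* (v - i J v) / 2, the identification of T^c with T^(1,0). *)
Definition part10 (v : Cspace R n) : CCspace :=
  cscale (2^-1)%:C (v, - mulI v).

(* The value of the Levi map, an element of
   (T_p M / T^c_p M) (x) C = (T_p M (x) C) / (T^c_p M (x) C), as a coset. *)
Definition levi_map (p v w : Cspace R n) : set CCspace :=
  [set b | exists L K : Cspace R n -> CCspace,
     [/\ section_at tangent10 p L, section_at tangent10 p K,
         L p = part10 v, K p = part10 w &
         complexify (complex_tangent p)
           (b - cscale (2 * 'i%C)^-1 (clie_bracket L (fun q => cconj (K q)) p))]].

Definition levi_nondegenerate (p : Cspace R n) : Prop :=
  forall v, complex_tangent p v ->
    (forall w, complex_tangent p w ->
       levi_map p v w = complexify (complex_tangent p)) ->
    v = 0.

End CR_structure.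

Definition quadric_set (R : realType) : set (Cspace R 9) :=
  [set p |
    let z (k : nat) : R[i] := coord p (inord k.-1) in
    let w (j : nat) : R[i] := coord p (inord (j + 3)%N) in
    [/\ (complex.Im (w 1%N))%:C = z 1%N * conjc (z 2%N) + z 2%N * conjc (z 1%N),
        (complex.Im (w 2%N))%:C = - 'i%C * z 1%N * conjc (z 2%N)
                                + 'i%C * z 2%N * conjc (z 1%N),
        (complex.Im (w 3%N))%:C = z 3%N * conjc (z 2%N) + z 4%N * conjc (z 1%N)
                                + z 2%N * conjc (z 3%N) + z 1%N * conjc (z 4%N),
        (complex.Im (w 4%N))%:C = z 1%N * conjc (z 1%N) &
        (complex.Im (w 5%N))%:C = z 2%N * conjc (z 2%N)]].

Section smooth_lemmas.
Context {R : realType} {V W : normedModType R}.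

Lemma CdiffW k (f : V -> W) : Cdiff k.+1 setT f -> Cdiff k setT f.
Proof.
elim: k f => [|k IH] f [fd fD] /=.
  by move=> p _; apply: differentiable_continuous; exact: fd.
by split=> [//|v]; apply: IH; exact: fD.
Qed.

Lemma Cdiff_cst k (c : W) : Cdiff k setT (fun _ : V => c).
Proof.
elim: k c => [|k IH] c; first by move=> p _; exact: cst_continuous.
split=> [p _|v]; first exact: differentiable_cst.
rewrite (_ : (fun p => 'D_v _ p) = fun=> 0); first exact: IH.
by apply/funext => p; rewrite derive_cst.
Qed.

Lemma CdiffD k (f g : V -> W) : Cdiff k setT f -> Cdiff k setT g ->
  Cdiff k setT (fun p => f p + g p).
Proof.
elim: k f g => [|k IH] f g.
  by move=> fc gc p _; apply: continuousD; [exact: fc|exact: gc].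
move=> [fd fD] [gd gD]; split=> [p _|v].
  by apply: differentiableD; [exact: fd|exact: gd].
rewrite (_ : (fun p => 'D_v _ p) = fun p => 'D_v f p + 'D_v g p).
  by apply: IH; [exact: fD|exact: gD].
apply/funext => p; apply: deriveD; apply: diff_derivable; [exact: fd|exact: gd].
Qed.

Lemma Cdiff_sum k m (F : 'I_m -> V -> W) : (forall i, Cdiff k setT (F i)) ->
  Cdiff k setT (fun p => \sum_i F i p).
Proof.
move=> FC; elim: (index_enum _) => [|i r IH].
  by under eq_fun do rewrite big_nil; exact: Cdiff_cst.
by under eq_fun do rewrite big_cons; exact: CdiffD.
Qed.

Lemma Cdiff_linear k (f : {linear V -> W}) : continuous f -> Cdiff k setT f.
Proof.
case: k => [|k] fc; first by move=> p _; exact: fc.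
split=> [p _|v]; first exact: linear_differentiable.
rewrite (_ : (fun p => 'D_v _ p) = fun=> f v); first exact: Cdiff_cst.
apply/funext => p; rewrite deriveE ?diff_lin//.
exact: linear_differentiable.
Qed.

End smooth_lemmas.

Lemma CdiffM (R : realType) (V : normedModType R) k (f g : V -> R) :
  Cdiff k setT f -> Cdiff k setT g -> Cdiff k setT (fun p => f p * g p).
Proof.
elim: k f g => [|k IH] f g.
  by move=> fc gc p _; apply: continuousM; [exact: fc|exact: gc].
move=> fC gC; have [fd fD] := fC; have [gd gD] := gC; split=> [p _|v].
  by apply: differentiableM; [exact: fd|exact: gd].
rewrite (_ : (fun p => 'D_v _ p) = fun p => f p * 'D_v g p + g p * 'D_v f p).
  by apply: CdiffD; apply: IH; [exact: CdiffW|exact: gD|exact: CdiffW|exact: fD].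
apply/funext => p; apply: deriveM; apply: diff_derivable; [exact: fd|exact: gd].
Qed.

Lemma Cdiff_scalel (R : realType) (V W : normedModType R) k (f : V -> R)
  (c : W) : Cdiff k setT f -> Cdiff k setT (fun p => f p *: c).
Proof.
elim: k f => [|k IH] f.
  by move=> fc p _; apply: continuousZl; exact: fc.
move=> [fd fD]; split=> [p _|v]; first exact/differentiableZl/fd.
rewrite (_ : (fun p => 'D_v _ p) = fun p => 'D_v f p *: c); first exact/IH/fD.
apply/funext => p; rewrite !deriveE ?diffZl//; try exact: fd.
exact/differentiableZl/fd.
Qed.

Lemma Cdiff_row (R : realType) (V : normedModType R) k m (F : 'I_m -> V -> R) :
  (forall i, Cdiff k setT (F i)) ->
  Cdiff k setT (fun p => \row_i F i p : 'rV[R]_m).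
Proof.
move=> FC; rewrite (_ : (fun p => \row_i _) = fun p => \sum_i F i p *: delta_mx 0 i).
  by apply: Cdiff_sum => i; exact: Cdiff_scalel.
apply/funext => p; rewrite [LHS]row_sum_delta.
by apply: eq_bigr => i _; rewrite mxE.
Qed.

Section coordinates.
Context {R : realType} {n : nat}.

Definition re_coord (i : 'I_n) (p : Cspace R n) : R := p.1 0 i.
Definition im_coord (i : 'I_n) (p : Cspace R n) : R := p.2 0 i.

Fact re_coord_linear i : linear (re_coord i).
Proof. by move=> a u v; rewrite /re_coord /= !mxE. Qed.
HB.instance Definition _ i := GRing.isLinear.Build _ _ _ _ _ (re_coord_linear i).

Fact im_coord_linear i : linear (im_coord i).
Proof. by move=> a u v; rewrite /im_coord /= !mxE. Qed.
HB.instance Definition _ i := GRing.isLinear.Build _ _ _ _ _ (im_coord_linear i).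

Lemma Cdiff_re_coord k i : Cdiff k setT (re_coord i).
Proof.
apply: Cdiff_linear => p.
apply: (@continuous_comp _ _ _ fst (fun x : 'rV[R]_n => x 0 i)).
  exact: cvg_fst.
exact: coord_continuous.
Qed.

Lemma Cdiff_im_coord k i : Cdiff k setT (im_coord i).
Proof.
apply: Cdiff_linear => p.
apply: (@continuous_comp _ _ _ snd (fun x : 'rV[R]_n => x 0 i)).
  exact: cvg_snd.
exact: coord_continuous.
Qed.

End coordinates.

Section quadric.
Context {R : realType}.

(* Im w - P(z, conj z) in real coordinates. *)
Definition quadric_eq (p : Cspace R 9) : 'rV[R]_5 :=
  let x k := re_coord (inord k.-1) p in
  let y k := im_coord (inord k.-1) p in
  \row_(j < 5) (im_coord (inord (j + 4)) p +
    [:: (-2) * (x 1%N * x 2%N + y 1%N * y 2%N);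
        (-2) * (y 1%N * x 2%N + (-1) * (x 1%N * y 2%N));
        (-2) * (x 3%N * x 2%N + y 3%N * y 2%N +
                (x 4%N * x 1%N + y 4%N * y 1%N));
        (-1) * (x 1%N * x 1%N + y 1%N * y 1%N);
        (-1) * (x 2%N * x 2%N + y 2%N * y 2%N)]`_j).

Lemma quadric_eqP (p : Cspace R 9) : quadric_set p <-> quadric_eq p = 0.
Proof.
rewrite /quadric_set /quadric_eq /coord /re_coord /im_coord /=.
split.
  case; rewrite /conjc; do 5! (simpc; case => ? ?).
  apply/rowP; case; do 5? [case => [|]] => //= ?; rewrite !mxE /=; lra.
move=> /rowP H.
have := H (inord 0); have := H (inord 1); have := H (inord 2).
have := H (inord 3); have := H (inord 4).
rewrite !mxE !inordK//= => h4 h3 h2 h1 h0.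
by split; simpc; congr (_ +i* _); lra.
Qed.

Lemma smooth_quadric_eq : smooth setT quadric_eq.
Proof.
move=> k; apply: Cdiff_row => j; apply: CdiffD; first exact: Cdiff_im_coord.
case: j; do 5? [case => [|]] => //= _;
  do ?[exact: Cdiff_re_coord | exact: Cdiff_im_coord
    | exact: Cdiff_cst | apply: CdiffM | apply: CdiffD].
Qed.

Lemma diff_quadric_eq_surj (q : Cspace R 9) (y : 'rV[R]_5) :
  exists v, 'd quadric_eq q v = y.
Proof.
pose v : Cspace R 9 := (0, \row_i (if (i < 4)%N then 0 else y 0 (inord (i - 4)))).
exists v; rewrite -deriveE; last by have [+ _] := smooth_quadric_eq 1; apply.
have shift (h : R) : quadric_eq (h *: v + q) = h *: y + quadric_eq q.
  apply/rowP => j; have j49 : (j + 4 < 9)%N by rewrite (ltn_add2r 4 j 5).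
  rewrite !mxE /re_coord /im_coord /= !mxE !(inordK j49) !inordK//=.
  by rewrite ltnNge leq_addl addnK inord_val !mulr0 !add0r -addrA.
apply: cvg_lim => //.
rewrite [X in X @ _ --> _](_ : _ = fun h : R => h^-1 *: (h *: y)); last first.
  by apply/funext => h /=; rewrite shift addrK.
apply: (@cvg_trans _ ((fun=> y) @ 0^')); last exact: cvg_cst.
apply: near_eq_cvg; near=> h.
rewrite scalerA mulVf ?scale1r//.
by near: h; exact: nbhs_dnbhs_neq.
Unshelve. all: by end_near. Qed.

Lemma quadric_local_equations (p : Cspace R 9) : quadric_set p ->
  exists (U : set (Cspace R 9)) (rho : Cspace R 9 -> 'rV[R]_5),
    [/\ open U, U p, smooth U rho,
        (forall q, U q -> (quadric_set q <-> rho q = 0)) &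
        (forall q, U q -> quadric_set q -> forall y, exists v, 'd rho q v = y)].
Proof.
move=> _; exists setT, quadric_eq; split => //.
- exact: openT.
- exact: smooth_quadric_eq.
- by move=> q _; exact: quadric_eqP.
- by move=> q _ _ y; exact: diff_quadric_eq_surj.
Qed.

Definition quadric : submanifold R 9 5 := Submanifold quadric_local_equations.

Lemma quadric0 : points quadric 0.
Proof.
by rewrite /= quadric_eqP; apply/rowP => j; rewrite !mxE /re_coord /im_coord /=
  !mxE !(mulr0, addr0, add0r); case: j; do 5? [case => [|]].
Qed.

End quadric.

Arguments quadric R : clear implicits.

(* Main.v *)
Require Import Defs.
From mathcomp Require Import all_boot all_order all_algebra.
From mathcomp Require Import all_classical all_reals all_analysis.
From mathcomp Require Import complex ring lra.

Set Implicit Arguments.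
Unset Strict Implicit.
Unset Printing Implicit Defensive.
Import Order.TTheory GRing.Theory Num.Theory.
Import numFieldNormedType.Exports.

Local Open Scope classical_set_scope.
Local Open Scope ring_scope.

(** Polarizing [P_j] gives symmetric real bilinear forms [polar j], invariant
    under [J = mulI], and [v] is tangent to [M] at [p] iff
    [Im v_{w_j} = polar j p v] for all [j]: as [P] is quadratic, such a [v] is
    the velocity of a curve [p + t v + t^2 u] in [M].  Hence every [a] in [C^4]
    extends to an affine section [crfield a] of the complex tangent bundle, and
    the bracket of [crfield a] and [crfield b] has [Re w_j]-components
    [2 polar j a (J b)] and all other components zero.  The five forms are
    linearly independent, which gives the spanning condition, and their common
    kernel is trivial, which gives non-degeneracy. *)

Section smoothness.
Context {R : realType}.

Lemma derive_pair (V W W' : normedModType R) (f : V -> W) (g : V -> W') p v :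
  differentiable f p -> differentiable g p ->
  'D_v (fun q => (f q, g q)) p = ('D_v f p, 'D_v g p).
Proof.
move=> fd gd; rewrite !deriveE//; last exact: differentiable_pair.
by rewrite diff_pair.
Qed.

Lemma Cdiff_pair (V W W' : normedModType R) k (f : V -> W) (g : V -> W') :
  Cdiff k setT f -> Cdiff k setT g -> Cdiff k setT (fun p => (f p, g p)).
Proof.
elim: k f g => [|k IH] f g.
  by move=> fc gc p _; apply: cvg_pair; [exact: fc|exact: gc].
move=> [fd fD] [gd gD]; split=> [p _|v].
  by apply: differentiable_pair; [exact: fd|exact: gd].
rewrite (_ : (fun p => 'D_v _ p) = fun p => ('D_v f p, 'D_v g p)).
  by apply: IH; [exact: fD|exact: gD].
by apply/funext => p; rewrite derive_pair//; [exact: fd|exact: gd].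
Qed.

Lemma CdiffN (V : normedModType R) k (f : V -> R) :
  Cdiff k setT f -> Cdiff k setT (fun p => - f p).
Proof.
move=> fC; under eq_fun do rewrite -mulN1r.
by apply: CdiffM => //; exact: Cdiff_cst.
Qed.

Lemma smooth_differentiable (V W : normedModType R) (U : set V) (f : V -> W) p :
  smooth U f -> U p -> differentiable f p.
Proof. by move=> /(_ 1%N)[+ _]; apply. Qed.

Lemma derive_affine (V W : normedModType R) (f : V -> W) p v y :
  (forall h : R, f (h *: v + p) = h *: y + f p) -> 'D_v f p = y.
Proof.
move=> fE; apply: cvg_lim => //.
rewrite [X in X @ _ --> _](_ : _ = fun h : R => h^-1 *: (h *: y)); last first.
  by apply/funext => h /=; rewrite fE addrK.
apply: (@cvg_trans _ ((fun=> y) @ 0^')); last exact: cvg_cst.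
apply: near_eq_cvg; near=> h.
rewrite scalerA mulVf ?scale1r//.
by near: h; exact: nbhs_dnbhs_neq.
Unshelve. all: by end_near. Qed.

Lemma is_derive_scalel (V : normedModType R) (f : R -> R) (t df : R) (c : V) :
  is_derive t (1 : R) f df -> is_derive t (1 : R) (fun s => f s *: c) (df *: c).
Proof.
move=> [/derivable1_diffP fd <-]; have fcd := differentiableZl c fd.
apply: DeriveDef; first exact/derivable1_diffP.
by rewrite !deriveE// diffZl.
Qed.

Lemma differentiable_re_coord n (i : 'I_n) (p : Cspace R n) :
  differentiable (re_coord i) p.
Proof. by have [+ _] := @Cdiff_re_coord R n 1%N i; apply. Qed.

Lemma differentiable_im_coord n (i : 'I_n) (p : Cspace R n) :
  differentiable (im_coord i) p.
Proof. by have [+ _] := @Cdiff_im_coord R n 1%N i; apply. Qed.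

Lemma is_derive_comp (V W : normedModType R) (f : V -> W) (c : R -> V) c' (t : R) :
  is_derive t 1 c c' -> differentiable f (c t) ->
  is_derive t 1 (fun s => f (c s)) ('D_c' f (c t)).
Proof.
move=> [/derivable1_diffP cd <-] fd.
have fcd : differentiable (f \o c) t by exact: differentiable_comp.
apply: DeriveDef; first exact/derivable1_diffP.
by rewrite deriveE// diff_comp//= !deriveE.
Qed.

Lemma is_derive_re_coord n (i : 'I_n) (c : R -> Cspace R n) c' (t : R) :
  is_derive t 1 c c' -> is_derive t 1 (fun s => re_coord i (c s)) (re_coord i c').
Proof.
move=> cc'; have cd := differentiable_re_coord i (c t).
apply: is_derive_eq; first exact: is_derive_comp cd.
rewrite deriveE// diff_lin// => p.
exact/differentiable_continuous/differentiable_re_coord.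
Qed.

Lemma is_derive_im_coord n (i : 'I_n) (c : R -> Cspace R n) c' (t : R) :
  is_derive t 1 c c' -> is_derive t 1 (fun s => im_coord i (c s)) (im_coord i c').
Proof.
move=> cc'; have cd := differentiable_im_coord i (c t).
apply: is_derive_eq; first exact: is_derive_comp cd.
rewrite deriveE// diff_lin// => p.
exact/differentiable_continuous/differentiable_im_coord.
Qed.

Lemma smooth_id : smooth setT (id : R -> R).
Proof. by move=> k; apply: (@Cdiff_linear _ _ _ k idfun) => x. Qed.

End smoothness.

Section coordinates.
Context {R : realType} {n : nat}.
Implicit Types (p q : Cspace R n) (i : 'I_n).

Lemma re_coordP i a p q :
  re_coord i (a *: p + q) = a * re_coord i p + re_coord i q.
Proof. by rewrite /re_coord !mxE. Qed.

Lemma im_coordP i a p q :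
  im_coord i (a *: p + q) = a * im_coord i p + im_coord i q.
Proof. by rewrite /im_coord !mxE. Qed.

Lemma re_coordZ i a p : re_coord i (a *: p) = a * re_coord i p.
Proof. by rewrite /re_coord mxE. Qed.

Lemma im_coordZ i a p : im_coord i (a *: p) = a * im_coord i p.
Proof. by rewrite /im_coord mxE. Qed.

Lemma re_coordB i p q : re_coord i (p - q) = re_coord i p - re_coord i q.
Proof. by rewrite /re_coord !mxE. Qed.

Lemma im_coordB i p q : im_coord i (p - q) = im_coord i p - im_coord i q.
Proof. by rewrite /im_coord !mxE. Qed.

Lemma re_coord_sum i m (F : 'I_m -> Cspace R n) :
  re_coord i (\sum_k F k) = \sum_k re_coord i (F k).
Proof. exact: linear_sum. Qed.

Lemma im_coord_sum i m (F : 'I_m -> Cspace R n) :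
  im_coord i (\sum_k F k) = \sum_k im_coord i (F k).
Proof. exact: linear_sum. Qed.

Lemma coord_eqP p q : (forall i, re_coord i p = re_coord i q) ->
  (forall i, im_coord i p = im_coord i q) -> p = q.
Proof. by case: p q => [a b] [c d] e f; congr (_, _); apply/rowP. Qed.

Lemma re_coordJ i p : re_coord i (mulI p) = - im_coord i p.
Proof. by rewrite /re_coord mxE. Qed.

Lemma im_coordJ i p : im_coord i (mulI p) = re_coord i p.
Proof. by []. Qed.

Lemma mulJK p : mulI (mulI p) = - p.
Proof. by case: p. Qed.

Lemma mulJN p : mulI (- p) = - mulI p.
Proof. by case: p. Qed.

Lemma mulJZ a p : mulI (a *: p) = a *: mulI p.
Proof. by case: p => x y; congr (_, _); rewrite /= scalerN. Qed.

End coordinates.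

Section levi_form.
Context {R : realType}.
Implicit Types (p q u v : Cspace R 9) (j : nat).

(* The polarization [P_j(p + q) - P_j(p) - P_j(q)] of the [j]-th defining form, with
   [j] counted from 0. *)
Definition polar j p q : R :=
  let x k := re_coord (inord k.-1) p in let y k := im_coord (inord k.-1) p in
  let x' k := re_coord (inord k.-1) q in let y' k := im_coord (inord k.-1) q in
  match j with
  | 0%N => 2 * (x 1%N * x' 2%N + y 1%N * y' 2%N + (x 2%N * x' 1%N + y 2%N * y' 1%N))
  | 1%N => 2 * (y 1%N * x' 2%N - x 1%N * y' 2%N + (x 2%N * y' 1%N - y 2%N * x' 1%N))
  | 2%N => 2 * (x 3%N * x' 2%N + y 3%N * y' 2%N + (x 4%N * x' 1%N + y 4%N * y' 1%N)
              + (x 2%N * x' 3%N + y 2%N * y' 3%N + (x 1%N * x' 4%N + y 1%N * y' 4%N)))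
  | 3%N => 2 * (x 1%N * x' 1%N + y 1%N * y' 1%N)
  | _ => 2 * (x 2%N * x' 2%N + y 2%N * y' 2%N)
  end.

Lemma polarC j p q : polar j p q = polar j q p.
Proof. by case: j => [|[|[|[|j]]]]; rewrite /polar; ring. Qed.

Lemma polarP j a p q u : polar j (a *: p + q) u = a * polar j p u + polar j q u.
Proof. by case: j => [|[|[|[|j]]]]; rewrite /polar !(re_coordP, im_coordP); ring. Qed.

Lemma polar_eq0 j p q : (forall i : 'I_9, (i < 4)%N -> re_coord i p = 0) ->
  (forall i : 'I_9, (i < 4)%N -> im_coord i p = 0) -> polar j p q = 0.
Proof.
by move=> x0 y0; case: j => [|[|[|[|j]]]]; rewrite /polar !x0 ?y0 ?inordK//; ring.
Qed.

Lemma polar0l j q : polar j 0 q = 0.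
Proof. by apply: polar_eq0 => i _; rewrite linear0. Qed.

Lemma polarDl j p q u : polar j (p + q) u = polar j p u + polar j q u.
Proof. by rewrite -[p]scale1r polarP mul1r scale1r. Qed.

Lemma polarZl j a p u : polar j (a *: p) u = a * polar j p u.
Proof. by rewrite -[a *: p]addr0 polarP polar0l addr0. Qed.

Lemma polarDr j p q u : polar j u (p + q) = polar j u p + polar j u q.
Proof. by rewrite polarC polarDl !(polarC j u). Qed.

Lemma polarZr j a p u : polar j u (a *: p) = a * polar j u p.
Proof. by rewrite polarC polarZl polarC. Qed.

Lemma polarNl j p q : polar j (- p) q = - polar j p q.
Proof. by rewrite -scaleN1r polarZl mulN1r. Qed.

Lemma polarNr j p q : polar j p (- q) = - polar j p q.
Proof. by rewrite polarC polarNl polarC. Qed.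

Lemma polarJ j p q : polar j (mulI p) (mulI q) = polar j p q.
Proof.
by case: j => [|[|[|[|j]]]]; rewrite /polar !re_coordJ !im_coordJ; ring.
Qed.

Lemma Cdiff_polar k j q : Cdiff k setT (fun p => polar j p q).
Proof.
by case: j => [|[|[|[|j]]]]; rewrite /polar;
  do ?[exact: Cdiff_re_coord | exact: Cdiff_im_coord
    | exact: Cdiff_cst | apply: CdiffM | apply: CdiffD | apply: CdiffN].
Qed.

Lemma is_derive_polar j (c g : R -> Cspace R 9) c' g' (t : R) :
  is_derive t 1 c c' -> is_derive t 1 g g' ->
  is_derive t 1 (fun s => polar j (c s) (g s)) (polar j c' (g t) + polar j (c t) g').
Proof.
move=> cc' gg'.
have rc k := is_derive_re_coord k cc'; have ic k := is_derive_im_coord k cc'.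
have rg k := is_derive_re_coord k gg'; have ig k := is_derive_im_coord k gg'.
by case: j => [|[|[|[|j]]]]; rewrite /polar; apply: is_derive_eq;
  rewrite /= /GRing.scale /=; ring.
Qed.

End levi_form.

Section quadric_tangent.
Context {R : realType}.
Implicit Types (p q u v : Cspace R 9) (j : nat).

Lemma points_quadricP p : points (quadric R) p <->
  forall i : 'I_9, (4 <= i)%N -> im_coord i p = polar (i - 4) p p / 2.
Proof.
rewrite /= quadric_eqP; split=> [/rowP H i i4|H].
  have i5 : (i - 4 < 5)%N by rewrite ltn_subLR.
  have := H (inord (i - 4)); rewrite !mxE inordK// subnK// inord_val.
  by move: (i - 4)%N i5; do 5? [case => [|]] => //= _; rewrite /polar /=; lra.
apply/rowP => j; have j9 : (j + 4 < 9)%N by rewrite (ltn_add2r 4 j 5).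
have := H (inord (j + 4)); rewrite inordK// leq_addl addnK => /(_ isT).
rewrite !mxE => ->; case: j {j9} => j /=.
by do 5? [case: j => [|j]] => //= _; rewrite /polar /=; lra.
Qed.

Lemma tangentP p v : points (quadric R) p ->
  tangent (quadric R) p v <->
  forall i : 'I_9, (4 <= i)%N -> im_coord i v = polar (i - 4) p v.
Proof.
move=> pM; split=> [[I [gamma [oI I0 sg gM [g0 g'0]]]] i i4|H].
  have gd : is_derive (0 : R) (1 : R) gamma v.
    by apply: DeriveDef => //; apply/derivable1_diffP/(smooth_differentiable sg).
  have d1 := is_derive_im_coord i gd.
  have d2 := is_derive_polar (i - 4) gd gd.
  have d3 : is_derive (0 : R) (1 : R) (cst 0 : R -> R)
     (im_coord i v - 2^-1 * (polar (i - 4) v (gamma 0) + polar (i - 4) (gamma 0) v)).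
    apply: near_eq_is_derive (is_deriveB d1 (is_deriveZ 2^-1 d2)).
    have : \forall t \near (0 : R), I t by exact: open_nbhs_nbhs.
    apply: filterS => t /gM /points_quadricP /(_ i i4) /= e.
    by rewrite fctE /= e /GRing.scale /= mulrC subrr.
  have := @derive_val _ _ _ _ _ _ _ d3.
  rewrite derive_cst g0 polarC; lra.
pose w : Cspace R 9 := (0, \row_i (if (i < 4)%N then 0 else polar (i - 4) v v / 2)).
exists setT, (fun t => p + (t *: v + (t * t) *: w)); split=> //.
- exact: openT.
- move=> k; apply: CdiffD; first exact: Cdiff_cst.
  apply: CdiffD; apply: Cdiff_scalel; first exact: smooth_id.
  by apply: CdiffM; exact: smooth_id.
- move=> t _; apply/points_quadricP => i i4.
  have w0 u : polar (i - 4) w u = 0.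
    by apply: polar_eq0 => k k4; rewrite /re_coord /im_coord !mxE ?k4.
  have wi : im_coord i w = polar (i - 4) v v / 2.
    by rewrite /im_coord mxE ltnNge i4.
  have -> : im_coord i (p + (t *: v + (t * t) *: w)) =
    im_coord i p + (t * im_coord i v + t * t * im_coord i w).
    by rewrite /im_coord !mxE.
  move/points_quadricP/(_ i i4) : pM => ->; rewrite H// wi.
  rewrite !(polarDl, polarDr, polarZl, polarZr, w0, polarC _ _ w).
  by rewrite (polarC _ v p); field.
- split; first by rewrite mulr0 !scale0r !addr0.
  have d1 := is_deriveM (is_derive_id (0 : R) 1) (is_derive_id (0 : R) 1).
  have d2 := is_deriveD (is_derive_cst p _ _) (is_deriveD
    (is_derive_scalel v (is_derive_id (0 : R) 1)) (is_derive_scalel w d1)).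
  rewrite (@derive_val _ _ _ _ _ _ _ d2).
  by rewrite add0r scale1r !scale0r addr0 scale0r addr0.
Qed.

Lemma tangent0P v : tangent (quadric R) 0 v <->
  forall i : 'I_9, (4 <= i)%N -> im_coord i v = 0.
Proof.
have H := tangentP v quadric0.
by split=> [/H tv i i4|tv]; [rewrite tv|apply/H => i i4; rewrite tv]; rewrite ?polar0l.
Qed.

Lemma complex_tangent0_re v (i : 'I_9) : complex_tangent (quadric R) 0 v ->
  (4 <= i)%N -> re_coord i v = 0.
Proof.
move=> [_ [u /tangent0P tu <-]] i4.
by rewrite re_coordJ tu// oppr0.
Qed.

Lemma derive_section X v (i : 'I_9) : section_at (quadric R) (tangent (quadric R)) 0 X ->
  tangent (quadric R) 0 v -> (4 <= i)%N ->
  im_coord i ('D_v X 0) = polar (i - 4) v (X 0).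
Proof.
move=> [U [oU U0 sX XM]] [I [gamma [oI I0 sg gM [g0 g'0]]]] i4.
have gdiff : differentiable gamma 0 by exact: smooth_differentiable sg I0.
have gd : is_derive (0 : R) (1 : R) gamma v.
  by apply: DeriveDef => //; apply/derivable1_diffP.
have Xd : differentiable X (gamma 0) by rewrite g0; exact: smooth_differentiable sX U0.
have d := is_derive_comp gd Xd.
have d1 := is_derive_im_coord i d.
have d2 := is_derive_polar (i - 4) gd d.
have d3 : is_derive (0 : R) (1 : R) (cst 0 : R -> R)
   (im_coord i ('D_v X (gamma 0)) - (polar (i - 4) v (X (gamma 0))
     + polar (i - 4) (gamma 0) ('D_v X (gamma 0)))).
  apply: near_eq_is_derive (is_deriveB d1 d2).
  have nI : \forall t \near (0 : R), I t by exact: open_nbhs_nbhs.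
  have nU : \forall t \near (0 : R), U (gamma t).
    have /(_ U) := differentiable_continuous gdiff.
    by apply; apply: open_nbhs_nbhs; rewrite g0.
  apply: filterS2 nI nU => t It Ut.
  have /(tangentP _ (gM _ It))/(_ i i4) e := XM _ Ut (gM _ It).
  by rewrite fctE /= e subrr.
have := @derive_val _ _ _ _ _ _ _ d3.
rewrite derive_cst g0 polar0l addr0 => /eqP.
by rewrite eq_sym subr_eq0 => /eqP.
Qed.

Lemma complex_tangentW p : complex_tangent (quadric R) p `<=` tangent (quadric R) p.
Proof. by move=> v []. Qed.

Lemma section_tangent p X : section_at (quadric R) (complex_tangent (quadric R)) p X ->
  section_at (quadric R) (tangent (quadric R)) p X.
Proof.
move=> [U [oU Up sX XM]]; exists U; split=> // q Uq qM.
exact/complex_tangentW/XM.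
Qed.

Lemma lie_bracket_tangent X Y :
  section_at (quadric R) (tangent (quadric R)) 0 X ->
  section_at (quadric R) (tangent (quadric R)) 0 Y ->
  tangent (quadric R) 0 (lie_bracket X Y 0).
Proof.
move=> sX sY; apply/tangent0P => i i4.
have tX : tangent (quadric R) 0 (X 0).
  by case: sX => U [_ U0 _]; apply=> //; exact: quadric0.
have tY : tangent (quadric R) 0 (Y 0).
  by case: sY => U [_ U0 _]; apply=> //; exact: quadric0.
apply/eqP; rewrite /lie_bracket im_coordB subr_eq0; apply/eqP.
apply: etrans (derive_section sY tX i4) _; rewrite polarC.
exact/esym/derive_section.
Qed.

Definition crfield (a q : Cspace R 9) : Cspace R 9 :=
  (\row_i (if (i < 4)%N then re_coord i a else polar (i - 4) q (mulI a)),
   \row_i (if (i < 4)%N then im_coord i a else polar (i - 4) q a)).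

Lemma re_crfield a q (i : 'I_9) : re_coord i (crfield a q) =
  if (i < 4)%N then re_coord i a else polar (i - 4) q (mulI a).
Proof. by rewrite {1}/re_coord mxE. Qed.

Lemma im_crfield a q (i : 'I_9) : im_coord i (crfield a q) =
  if (i < 4)%N then im_coord i a else polar (i - 4) q a.
Proof. by rewrite {1}/im_coord mxE. Qed.

Lemma polar_crfield j a q p : polar j (crfield a q) p = polar j a p.
Proof.
rewrite -[crfield a q](subrK a) polarDl polar_eq0 ?add0r// => i i4.
  by rewrite re_coordB re_crfield i4 subrr.
by rewrite im_coordB im_crfield i4 subrr.
Qed.

Lemma crfieldJ a q : mulI (crfield a q) = crfield (mulI a) q.
Proof.
apply: coord_eqP => i; rewrite ?re_coordJ ?im_coordJ re_crfield im_crfield.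
  by rewrite re_coordJ mulJK polarNr; case: ifP.
by [].
Qed.

Lemma crfieldZ c a q : crfield (c *: a) q = c *: crfield a q.
Proof.
apply: coord_eqP => i.
  by rewrite re_coordZ !re_crfield mulJZ polarZr (re_coordZ i c a); case: ifP.
by rewrite im_coordZ !im_crfield polarZr (im_coordZ i c a); case: ifP.
Qed.

Lemma crfieldN a q : crfield (- a) q = - crfield a q.
Proof. by rewrite -scaleN1r crfieldZ scaleN1r. Qed.

Lemma crfield_tangent a q : points (quadric R) q -> tangent (quadric R) q (crfield a q).
Proof.
move=> qM; apply/tangentP => // i i4.
by rewrite im_crfield ltnNge i4 [RHS]polarC polar_crfield polarC.
Qed.

Lemma crfield_complex_tangent a q : points (quadric R) q ->
  complex_tangent (quadric R) q (crfield a q).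
Proof.
move=> qM; split; first exact: crfield_tangent.
exists (crfield (- mulI a) q); first exact: crfield_tangent.
by rewrite crfieldJ mulJN mulJK opprK.
Qed.

Lemma smooth_crfield a : smooth setT (crfield a).
Proof.
by move=> k; apply: Cdiff_pair; apply: Cdiff_row => i; case: (i < 4)%N;
  do ?[exact: Cdiff_cst|exact: Cdiff_polar].
Qed.

Lemma section_crfield a p :
  section_at (quadric R) (complex_tangent (quadric R)) p (crfield a).
Proof.
exists setT; split; [exact: openT|by []|exact: smooth_crfield|].
by move=> q _; exact: crfield_complex_tangent.
Qed.

Lemma derive_crfield a p v : 'D_v (crfield a) p =
  (\row_i (if (i < 4)%N then 0 else polar (i - 4) v (mulI a)),
   \row_i (if (i < 4)%N then 0 else polar (i - 4) v a)).
Proof.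
apply: derive_affine => h; apply: coord_eqP => i.
  rewrite re_coordP !re_crfield [re_coord i (_, _)]/re_coord mxE polarP.
  by case: ifP => // _; rewrite mulr0 add0r.
rewrite im_coordP !im_crfield [im_coord i (_, _)]/im_coord mxE polarP.
by case: ifP => // _; rewrite mulr0 add0r.
Qed.

Lemma re_bracket_crfield a b p (i : 'I_9) :
  re_coord i (lie_bracket (crfield a) (crfield b) p) =
  if (i < 4)%N then 0 else 2 * polar (i - 4) a (mulI b).
Proof.
rewrite /lie_bracket !derive_crfield /re_coord !mxE !polar_crfield.
case: ifP => _; first by rewrite subrr.
by rewrite -(polarJ _ b) mulJK polarNr (polarC _ (mulI b)); ring.
Qed.

Lemma im_bracket_crfield a b p (i : 'I_9) :
  im_coord i (lie_bracket (crfield a) (crfield b) p) = 0.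
Proof.
rewrite /lie_bracket !derive_crfield /im_coord !mxE !polar_crfield.
by case: ifP => _; rewrite ?subrr// polarC subrr.
Qed.

Definition zbasis (k : nat) : Cspace R 9 := (\row_(i < 9) (i == k :> nat)%:R, 0).

Lemma re_zbasis k (i : 'I_9) : re_coord i (zbasis k) = (i == k :> nat)%:R.
Proof. by rewrite /re_coord mxE. Qed.

Lemma im_zbasis k (i : 'I_9) : im_coord i (zbasis k) = 0.
Proof. by rewrite /im_coord mxE. Qed.

Definition dual_pair (j : nat) : Cspace R 9 * Cspace R 9 :=
  match j with
  | 0%N => (zbasis 0, zbasis 1)
  | 1%N => (mulI (zbasis 0), zbasis 1)
  | 2%N => (zbasis 2, zbasis 1)
  | 3%N => (zbasis 0, zbasis 0)
  | _ => (zbasis 1, zbasis 1)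
  end.

Lemma polar_dual_pair j k : (j < 5)%N -> (k < 5)%N ->
  polar k (dual_pair j).1 (dual_pair j).2 = 2 * (k == j)%:R.
Proof.
do 5? [case: j => [|j]] => //= _; do 5? [case: k => [|k]] => //= _;
  rewrite /polar ?re_coordJ ?im_coordJ !re_zbasis !im_zbasis !inordK//=; ring.
Qed.

Lemma quadric_levi_generating : levi_generating (quadric R) 0.
Proof.
apply/seteqP; split=> v /=.
  move=> [m [c [s [sS ->]]]]; apply/tangent0P => i i4.
  rewrite im_coord_sum big1// => k _; rewrite im_coordZ.
  suff /tangent0P -> : tangent (quadric R) 0 (s k) by rewrite ?mulr0.
  case: (sS k) => [[X [U [_ U0 _ XM]] ->]|[X [Y [sX sY ->]]]].
    exact/complex_tangentW/XM/quadric0.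
  by apply: lie_bracket_tangent; exact: section_tangent.
move=> /tangent0P tv.
pose br j := lie_bracket (crfield (dual_pair j).1)
  (crfield (- mulI (dual_pair j).2)) (0 : Cspace R 9).
exists 6, (fun k => if unlift ord0 k is Some j then
    re_coord (inord (j + 4)) v / 4 else 1),
  (fun k => if unlift ord0 k is Some j then br j else crfield v 0); split.
  move=> k; case: unliftP => [j _|_]; last first.
    by left; exists (crfield v) => //; exact: section_crfield.
  right; exists (crfield (dual_pair j).1), (crfield (- mulI (dual_pair j).2)).
  by split=> //; exact: section_crfield.
rewrite big_ord_recl unlift_none scale1r.
under eq_bigr do rewrite liftK.
apply: coord_eqP => i.
  rewrite linearD /= re_coord_sum re_crfield polar0l; case: ltnP => i4.
    rewrite big1 ?addr0// => j _; rewrite re_coordZ re_bracket_crfield i4 mulr0//.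
  have i5 : (i - 4 < 5)%N by rewrite ltn_subLR.
  rewrite add0r (bigD1 (Ordinal i5))//= big1 => [|j ji].
    rewrite addr0 re_coordZ re_bracket_crfield ltnNge i4/= subnK// inord_val.
    by rewrite mulJN mulJK opprK polar_dual_pair// eqxx mulr1; field.
  rewrite re_coordZ re_bracket_crfield ltnNge i4/= mulJN mulJK opprK.
  rewrite polar_dual_pair// eq_sym -[(_ == _)]/(j == Ordinal i5) (negbTE ji).
  by rewrite !mulr0.
rewrite linearD /= im_coord_sum im_crfield polar0l big1 => [|j _].
  by rewrite addr0; case: ltnP => // i4; rewrite tv.
by rewrite im_coordZ im_bracket_crfield mulr0.
Qed.

Lemma crfield0 v : complex_tangent (quadric R) 0 v -> crfield v 0 = v.
Proof.
move=> tv; have /tangent0P tv' := complex_tangentW tv.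
by apply: coord_eqP => i; rewrite (re_crfield, im_crfield); case: ltnP => // i4;
  rewrite polar0l ?(complex_tangent0_re tv)// tv'.
Qed.

Lemma part10_crfield a q :
  part10 (crfield a q) = (crfield (2^-1 *: a) q, crfield (- (2^-1 *: mulI a)) q).
Proof.
rewrite /part10 /Defs.cscale /= !scale0r subr0 addr0 scalerN.
by rewrite crfieldN !crfieldZ crfieldJ.
Qed.

Lemma section10_crfield a p :
  section_at (quadric R) (tangent10 (quadric R)) p (fun q => part10 (crfield a q)).
Proof.
exists setT; split; [exact: openT|by []| |] => [k|q _ qM].
  under eq_fun do rewrite part10_crfield.
  by apply: Cdiff_pair; exact: smooth_crfield.
rewrite part10_crfield; split; first by split; exact: crfield_tangent.
rewrite /= !crfieldJ /Defs.cscale /= !scale0r !scale1r sub0r add0r -crfieldN.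
by rewrite opprK mulJN !mulJZ mulJK scalerN opprK.
Qed.

Lemma inv_2i : (2 * 'i%C)^-1 = Complex 0 (- 2^-1) :> R[i].
Proof.
have e : 2 * 'i%C * Complex 0 (- 2^-1) = 1 :> R[i].
  rewrite mulr_natl mulr2n; apply/eqP; rewrite eq_complex /=.
  by apply/andP; split; apply/eqP; field.
have nz : 2 * 'i%C != 0 :> R[i].
  by apply/eqP => z; move: e => /eqP; rewrite z mul0r eq_sym oner_eq0.
by apply: (mulfI nz); rewrite e divff.
Qed.

Lemma complex_tangent00 : complex_tangent (quadric R) 0 0.
Proof.
have := crfield_complex_tangent 0 quadric0.
by rewrite -[X in crfield X _](scale0r 0) crfieldZ scale0r.
Qed.

Lemma re_clie_bracket (i : 'I_9) (X1 X2 Y1 Y2 : Cspace R 9 -> Cspace R 9) p :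
  re_coord i (clie_bracket (fun q => (X1 q, X2 q)) (fun q => (Y1 q, Y2 q)) p).2 =
  re_coord i (lie_bracket X1 Y2 p) + re_coord i (lie_bracket X2 Y1 p).
Proof. by rewrite [LHS]mxE. Qed.

Lemma re_clie_bracket_crfield a b (i : 'I_9) : (4 <= i)%N ->
  re_coord i (clie_bracket (fun q => part10 (crfield a q))
    (fun q => cconj (part10 (crfield b q))) 0).2 = - polar (i - 4) a b.
Proof.
move=> i4.
have -> : (fun q => part10 (crfield a q)) =
    (fun q => (crfield (2^-1 *: a) q, crfield (- (2^-1 *: mulI a)) q)).
  by apply/funext => q; rewrite part10_crfield.
have -> : (fun q => cconj (part10 (crfield b q))) =
    (fun q => (crfield (2^-1 *: b) q, crfield (2^-1 *: mulI b) q)).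
  by apply/funext => q; rewrite part10_crfield /cconj /= crfieldN opprK.
rewrite re_clie_bracket.
(* Rewriting one bracket would test it for conversion with the other one. *)
apply: etrans (congr2 +%R (re_bracket_crfield _ _ _ i) (re_bracket_crfield _ _ _ i)) _.
rewrite ltnNge i4 /= !mulJZ mulJK.
rewrite !(polarNl, polarNr, polarZl, polarZr) polarJ.
by field.
Qed.

Lemma quadric_levi_nondegenerate : levi_nondegenerate (quadric R) 0.
Proof.
move=> v tv Hv.
have vb j b : (j < 5)%N -> polar j v b = 0.
  move=> j5; have j9 : (j + 4 < 9)%N by rewrite (ltn_add2r 4 j 5).
  have := Hv _ (crfield_complex_tangent b quadric0).
  pose L q := part10 (crfield v q); pose K q := part10 (crfield b q).
  move/seteqP => [+ _].
  move/(_ (Defs.cscale (2 * 'i%C)^-1 (clie_bracket L (fun q => cconj (K q)) 0))).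
  case.
    exists L, K; split; [exact: section10_crfield|exact: section10_crfield| |by []|].
      by rewrite /L crfield0.
    by rewrite subrr; split; exact: complex_tangent00.
  have i4 : (4 <= Ordinal j9)%N by rewrite leq_addl.
  move=> /complex_tangent0_re/(_ i4) + _.
  rewrite inv_2i /Defs.cscale /= scale0r sub0r scaleNr opprK.
  by rewrite re_coordZ re_clie_bracket_crfield//= addnK; lra.
have re0 k : (k < 4)%N -> re_coord (inord k) v = 0.
  have := vb 2%N (zbasis 0) isT.
  have := vb 2%N (zbasis 1) isT.
  have := vb 3%N (zbasis 0) isT.
  have := vb 4%N (zbasis 1) isT.
  rewrite /polar !re_zbasis !im_zbasis !inordK//= => h1 h2 h3 h4.
  by do 4? [case: k => [|k]] => //= _; lra.
have im0 k : (k < 4)%N -> im_coord (inord k) v = 0.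
  have := vb 2%N (mulI (zbasis 0)) isT.
  have := vb 2%N (mulI (zbasis 1)) isT.
  have := vb 3%N (mulI (zbasis 0)) isT.
  have := vb 4%N (mulI (zbasis 1)) isT.
  rewrite /polar !re_coordJ !im_coordJ !re_zbasis !im_zbasis !inordK//= => h1 h2 h3 h4.
  by do 4? [case: k => [|k]] => //= _; lra.
apply: coord_eqP => i; rewrite linear0; case: (ltnP i 4) => i4.
- by rewrite -(inord_val i) re0.
- exact: complex_tangent0_re tv i4.
- by rewrite -(inord_val i) im0.
- by have /tangent0P -> := complex_tangentW tv.
Qed.

End quadric_tangent.

Theorem proposition3 (R : realType) :
  levi_generating (quadric R) 0 /\ levi_nondegenerate (quadric R) 0.
Proof.
by split; [exact: quadric_levi_generating|exact: quadric_levi_nondegenerate].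
Qed.
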